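(* Let $d\ge 0$ be an integer and let $L:\mathbb{C}_{2d+2}[z,\overline{z}]\to\mathbb{C}$ be a real linear functional which is non-negative on hermitian squares, i.e. $L(|f(z)|^2)\ge 0$ for all $f\in\mathbb{C}_{d+1}[z]$. Assume moreover that multiplication by $z$ is well defined on the quotient space $A_d$, i.e. for $p\in\mathbb{C}_d[z]$, $L(|p|^2)=0$ implies $L(|zp|^2)=0$ (this holds for instance if $L(|p|^2)>0$ for every nonzero $p\in\mathbb{C}_d[z]$). Let $R=\|M_d\|$ be the operator norm of the compressed multiplier $M_d=\pi_d M_z|_{A_d}:A_d\to A_d$. Then there exist an integer $N\le (d+1)^2$, points $z_1,\dots,z_N\in\mathbb{C}$ with $|z_k|=R$ (i.e. $z_k=Re^{i\theta_k}$ with $\theta_k\in\mathbb{R}$), and weights $c_1,\dots,c_N>0$ such that $$L(h)=\sum_{k=1}^N c_k\, h(z_k,\overline{z_k})$$ for every harmonic polynomial $h\in\mathbb{C}_{d,d}[z,\overline{z}]$ (i.e. every $h$ of degree at most $d$ in $z$ and at most $d$ in $\overline z$ with $\partial_z\partial_{\overline z}h=0$; equivalently $h=p(z)+\overline{q(z)}$ with $p,q\in\mathbb{C}_d[z]$).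
   Context: Notation: $z=x+iy$ is the complex variable on $\mathbb{C}\cong\mathbb{R}^2$. For an integer $n\ge0$, $\mathbb{C}_n[z]$ is the space of complex polynomials in $z$ of degree $\le n$; $\mathbb{C}_n[z,\overline z]$ is the space of complex polynomials in $z,\overline z$ (equivalently in $x,y$) of total degree $\le n$; $\mathbb{C}_{k,\ell}[z,\overline z]$ is the space of polynomials of degree $\le k$ in $z$ and $\le \ell$ in $\overline z$. A linear functional $L$ on $\mathbb{C}_{2m}[z,\overline z]$ is called real if $L(\overline{p})=\overline{L(p)}$ for all $p$. Hilbert space setup: for $L$ as in the statement, $\langle p,q\rangle_L=L(p\overline q)$ is a positive semidefinite hermitian form on $\mathbb{C}_{d+1}[z]$, with null space $N=\{p\in\mathbb{C}_{d+1}[z]: L(|p|^2)=0\}$. For $k\le d+1$, $A_k=\mathbb{C}_k[z]/(\mathbb{C}_k[z]\cap N)$ is a finite-dimensional Hilbert space with the induced inner product, and $A_0\subseteq A_1\subseteq\dots\subseteq A_{d+1}$. $\pi_d$ denotes the orthogonal projection of $A_{d+1}$ onto $A_d$. $M_z:A_d\to A_{d+1}$ is the (assumed well-defined) map induced by $p\mapsto zp$, and $M_d=\pi_d M_z|_{A_d}$ is its compression, a linear endomorphism of $A_d$. *)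

(* Defs.v *)
From HB Require Import structures.
From mathcomp Require Import all_boot all_order all_algebra.
Set Implicit Arguments. Unset Strict Implicit. Unset Printing Implicit Defensive.
Import Order.TTheory GRing.Theory Num.Theory.
Local Open Scope ring_scope.

(* Polynomials in z and zbar are represented as {poly {poly C}}:
   the OUTER variable is zbar, the INNER variable is z.
   bicoef p j k = coefficient of z^j zbar^k. *)
Definition bicoef (C : nzRingType) (p : {poly {poly C}}) (j k : nat) : C :=
  (p`_k)`_j.

(* the monomial z^j zbar^k *)
Definition bimono (C : nzRingType) (j k : nat) : {poly {poly C}} :=
  ('X^j)%:P * 'X^k.

(* p has total degree <= n *)
Definition in_tdeg (C : nzRingType) (n : nat) (p : {poly {poly C}}) : Prop :=
  forall j k : nat, (n < j + k)%N -> bicoef p j k = 0.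

(* p has degree <= a in z and <= b in zbar *)
Definition in_bideg (C : nzRingType) (a b : nat) (p : {poly {poly C}}) : Prop :=
  forall j k : nat, ((a < j)%N || (b < k)%N) -> bicoef p j k = 0.

(* complex conjugate polynomial: conj(sum c_jk z^j zbar^k) = sum conj(c_jk) z^k zbar^j *)
Definition biconj (C : numClosedFieldType) (p : {poly {poly C}}) : {poly {poly C}} :=
  \sum_(k < size p) \sum_(j < size p`_k)
     ((bicoef p j k)^*)%:P%:P * bimono C k j.

(* evaluation h(z, conj z) *)
Definition eval2 (C : numClosedFieldType) (p : {poly {poly C}}) (z : C) : C :=
  (map_poly (fun q : {poly C} => q.[z]) p).[z^*].

(* d/dz d/dzbar h = 0 *)
Definition harmonic (C : nzRingType) (p : {poly {poly C}}) : Prop :=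
  map_poly (@deriv C) (deriv p) = 0.

(* the semi-inner product <p, q>_L = L(p * conj q) on C[z] *)
Definition ipL (C : numClosedFieldType) (L : {poly {poly C}} -> C) (p q : {poly C}) : C :=
  L (p%:P * biconj q%:P).

(* Values ||pi_d M_z x|| for x in A_d with ||x|| <= 1.  x is represented by
   p in C_d[z]; pi_d (z p) is represented by any w in C_d[z] with
   z p - w orthogonal to C_d[z]; the norm is sqrt <w,w>_L. *)
Definition Md_values (C : numClosedFieldType) (L : {poly {poly C}} -> C) (d : nat)
    (r : C) : Prop :=
  exists p w : {poly C},
    [/\ (size p <= d.+1)%N, (size w <= d.+1)%N, ipL L p p <= 1,
        (forall q : {poly C}, (size q <= d.+1)%N -> ipL L ('X * p - w) q = 0)
      & r = sqrtC (ipL L w w)].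

(* R = ||M_d|| = sup { ||M_d x|| : ||x|| <= 1 } (least upper bound) *)
Definition is_opnorm_Md (C : numClosedFieldType) (L : {poly {poly C}} -> C) (d : nat)
    (R : C) : Prop :=
  (forall r, Md_values L d r -> r <= R) /\
  (forall R', (forall r, Md_values L d r -> r <= R') -> R <= R').

(* Main.v *)
(* Let [t_j = L(z^j) / R^j] (when [R > 0]).  For [p] of degree at most [d],
   put [y(z) = p(z / R)]; peeling off the constant term, [p = a_0 + z p'] and
   [y = a_0 + (z / R) y'], the Toeplitz form satisfies
   [Q(p) = Q(p') + |y|^2 - |(z / R) y'|^2 >= Q(p') + |y|^2 - |y'|^2],
   because only multiplication by [z] from degree [< d] to degree [<= d] enters,
   where no projection is needed; by induction [Q(p) >= |y|^2 >= 0].  A positive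
   semidefinite Toeplitz matrix is the Gram matrix of vectors [b_0, ..., b_d] for
   which the shift [b_i -> b_(i+1)] is isometric; it extends to a unitary matrix,
   whose spectral decomposition yields at most [d + 1] atoms on the unit circle
   with moments [t_j].  No completeness of the field is involved. *)
Require Import Defs.
From HB Require Import structures.
From mathcomp Require Import all_boot all_order all_algebra.
From mathcomp Require Import ring.
From mathcomp Require Import zify.
Import Order.TTheory GRing.Theory Num.Theory.
Local Open Scope ring_scope.

(** * Positive semidefinite Toeplitz matrices and unitary extensions *)

Definition toeplitz_coef {C : numClosedFieldType} (t : nat -> C) (i j : nat) : C :=
  if (j <= i)%N then t (i - j)%N else (t (j - i)%N)^*.

Section Unitary.
Local Open Scope sesquilinear_scope.
Variable C : numClosedFieldType.

Lemma adjM m n p (A : 'M[C]_(m, n)) (B : 'M_(n, p)) :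
  (A *m B)^t* = B^t* *m A^t*.
Proof. by rewrite trmx_mul map_mxM. Qed.

Lemma adjB m n (A B : 'M[C]_(m, n)) : (A - B)^t* = A^t* - B^t*.
Proof. by rewrite linearB map_mxB. Qed.

Lemma adjZ m n a (A : 'M[C]_(m, n)) : (a *: A)^t* = a^* *: A^t*.
Proof. by rewrite linearZ map_mxZ. Qed.

(** Diagonalise [G] as [P^* D P] with [P] unitary. Testing positivity on the rows of [P] shows that
    the eigenvalues are non-negative, so [P^* sqrt(D)] is a Gram factor. *)
Lemma psd_gram n (G : 'M[C]_n) :
    (forall i j, G j i = (G i j)^*) ->
    (forall u : 'rV_n, 0 <= (u *m G *m u^t*) 0 0) ->
  exists B : 'M[C]_n, G = B *m B^t*.
Proof.
move=> Gsym Gpos.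
have Gh : G \is hermsymmx.
  apply/is_hermitianmxP; rewrite expr0 scale1r; apply/matrixP=> i j.
  by rewrite !mxE -Gsym.
have /orthomx_spectralP GE := hermitian_normalmx Gh.
have Pu := spectral_unitarymx G.
move: (spectralmx G) (spectral_diag G) GE Pu => P D.
move=> GE Pu; rewrite (invmx_unitary Pu) in GE.
have D_ge0 i : 0 <= D 0 i.
  have := Gpos (row i P).
  have -> : (row i P *m G *m (row i P)^t*) 0 0 = (P *m G *m P^t*) i i.
    by rewrite -row_mul !mxE; apply: eq_bigr => k _; rewrite !mxE.
  rewrite {1}GE !mulmxA (unitarymxP Pu) mul1mx mulmxtVK //.
  by rewrite mxE eqxx mulr1n.
exists (P^t* *m diag_mx (map_mx sqrtC D)).
rewrite {1}GE adjM trmxCK !mulmxA; congr (_ *m _).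
rewrite -!mulmxA; congr (_ *m _); rewrite tr_diag_mx map_diag_mx mulmx_diag.
congr diag_mx; apply/rowP=> i; rewrite !mxE.
rewrite [RHS](_ : _ = sqrtC (D 0 i) * (sqrtC (D 0 i))^*) //.
by rewrite conj_Creal ?ger0_real ?sqrtC_ge0 // -expr2 sqrtCK.
Qed.

(* A complex Householder reflection [1 - s^-1 u^* u] with [u = x - b] and
   [s = <x, u>]; it is unitary because [s + s^* = |u|^2]. *)
Lemma unitary_move n (x b : 'rV[C]_n) :
    x *m x^t* = b *m b^t* ->
  exists W : 'M[C]_n, [/\ W \is unitarymx, x *m W = b &
    forall v : 'rV_n, v *m (x - b)^t* = 0 -> v *m W = v].
Proof.
move=> xb; move uE: (x - b) => u.
have [s sE] : exists s, x *m u^t* = s%:M by eexists; apply: mx11_scalar.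
have ssE : s^*%:M = u *m x^t*.
  by rewrite -[RHS]trmxCK adjM trmxCK sE tr_scalar_mx map_scalar_mx.
have uu : u *m u^t* = (s + s^*)%:M.
  transitivity (x *m u^t* + u *m x^t*); last by rewrite -ssE sE -raddfD.
  rewrite -uE adjB !mulmxBl !mulmxBr xb.
  by rewrite opprB.
exists (1%:M - s^-1 *: (u^t* *m u)); split.
- apply/unitarymxP.
  rewrite adjB trmx1 map_mx1 adjZ adjM trmxCK.
  rewrite mulmxBl !mulmxBr !mul1mx mulmx1 -scalemxAl -scalemxAr.
  have -> : u^t* *m u *m (u^t* *m u) = (s + s^*) *: (u^t* *m u).
    by rewrite -mulmxA (mulmxA u) uu mul_scalar_mx -scalemxAr.
  move: (u^t* *m u) => E; have [->|s0] := eqVneq s 0.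
    by rewrite invr0 conjC0 !scale0r !subr0.
  have sc0 : s^* != 0 by rewrite conjC_eq0.
  by apply/matrixP=> i j; rewrite fmorphV !mxE /=; field; apply/andP.
- rewrite mulmxBr mulmx1 -scalemxAr mulmxA sE mul_scalar_mx scalerA.
  (* If [s = 0], its inverse is 0 by convention and the reflection is the identity. This is
     harmless: the squared norm of [u] is [s + s^* = 0], so [x = b] already. *)
  have [s0|s0] := eqVneq s 0; last by rewrite mulVf // scale1r -uE subKr.
  rewrite s0 mulr0 scale0r subr0; apply/eqP; rewrite -subr_eq0 uE.
  by rewrite -(dnorm_eq0 (@dotmx C n)) /= dotmxE uu s0 conjC0 addr0 mxE.
- move=> v vu; rewrite mulmxBr mulmx1 -scalemxAr mulmxA vu mul0mx scaler0.
  by rewrite subr0.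
Qed.

(** Vectors are treated one at a time. Once [U] sends [a i] to [b i] for [i < m], a reflection [W]
    carries [a m *m U] to [b m]. It fixes every earlier [b i], because [<b i, a m U> = <a i U, a m
    U> = <a i, a m> = <b i, b m>] makes [b i] orthogonal to the difference [a m U - b m]. *)
Lemma unitary_extension n m (a b : nat -> 'rV[C]_n) :
    (forall i j, (i < m)%N -> (j < m)%N -> a i *m (a j)^t* = b i *m (b j)^t*) ->
  exists2 U : 'M[C]_n, U \is unitarymx & forall i, (i < m)%N -> a i *m U = b i.
Proof.
elim: m => [_|m IH ab].
  by exists 1%:M => //; apply/unitarymxP; rewrite mul1mx trmx1 map_mx1.
have [i j im jm|U Uu UE] := IH; first by apply: ab; rewrite ltnW.
have [|W [Wu WE Wid]] := @unitary_move n (a m *m U) (b m).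
  by rewrite adjM mulmxA mulmxtVK // ab.
exists (U *m W); first exact: mul_unitarymx.
move=> i; rewrite ltnS leq_eqVlt => /predU1P[->|im]; rewrite mulmxA //.
rewrite UE // Wid // adjB mulmxBr -[in X in X - _]UE // adjM mulmxA mulmxtVK //.
by rewrite ab ?subrr // ltnW.
Qed.

(** A unitary matrix is normal, hence unitarily diagonalisable. Its diagonal form is a product of
    unitary matrices, so the eigenvalues have modulus one. *)
Lemma unitary_spectrum n (U : 'M[C]_n) : U \is unitarymx ->
  exists P (D : 'rV_n), [/\ P \is unitarymx, U = P^t* *m diag_mx D *m P &
    forall i, `|D 0 i| = 1].
Proof.
move=> Uu; have Un : U \is normalmx.
  by apply/normalmxP; rewrite (unitarymxP Uu) -invmx_unitary // mulVmx ?unitarymx_unit.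
have /orthomx_spectralP UE := Un.
have Pu := spectral_unitarymx U.
move: (spectralmx U) (spectral_diag U) UE Pu => P D UE Pu.
rewrite (invmx_unitary Pu) in UE.
exists P, D; split=> // i.
have : diag_mx D \is unitarymx.
  have -> : diag_mx D = P *m U *m P^t*.
    by rewrite UE !mulmxA mulmxtVK // (unitarymxP Pu) mul1mx.
  by rewrite !mul_unitarymx // trmxC_unitary.
move=> /unitarymxP/matrixP/(_ i i).
rewrite tr_diag_mx map_diag_mx mulmx_diag !mxE eqxx !mulr1n -normCK => /eqP.
by rewrite pexpr_eq1 ?normr_ge0 // => /eqP.
Qed.

(** With [b j = b 0 U^j], the number [t j = <b j, b 0>] is the [j]-th moment of the spectral measure
    of [U] at [b 0]: the atoms are the eigenvalues, and the weights are the squared moduli of the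
    coordinates of [b 0] in an eigenbasis. *)
Lemma toeplitz_moments n (t : nat -> C) :
    (t 0%N)^* = t 0%N ->
    (forall a : nat -> C, 0 <= \sum_(i < n.+1) \sum_(j < n.+1)
       a i * (a j)^* * toeplitz_coef t i j) ->
  exists (w z : 'I_n.+1 -> C), [/\ forall k, 0 <= w k, forall k, `|z k| = 1 &
    forall j, (j <= n)%N -> t j = \sum_k w k * z k ^+ j].
Proof.
move=> t0 tpos; pose G := \matrix_(i < n.+1, j < n.+1) toeplitz_coef t i j.
have [||B GB] := @psd_gram _ G.
- move=> i j; rewrite !mxE /toeplitz_coef.
  by case: ltngtP => [||->]; rewrite ?conjCK // subnn t0.
- move=> u; have := tpos (fun i => u 0 (inord i)); congr (_ <= _).
  rewrite mxE exchange_big; apply: eq_bigr => j _.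
  rewrite !mxE mulr_suml; apply: eq_bigr => i _.
  by rewrite !mxE !inord_val mulrAC.
pose b i : 'rV_n.+1 := row (inord i) B.
have bE i j : (i <= n)%N -> (j <= n)%N ->
    b i *m (b j)^t* = (toeplitz_coef t i j)%:M.
  move=> i_n j_n; rewrite [LHS]mx11_scalar; congr _%:M.
  have /matrixP/(_ (inord i) (inord j)) := GB.
  rewrite !mxE !inordK ?ltnS // => ->.
  by apply: eq_bigr => k _; rewrite !mxE.
(* Constancy along diagonals says exactly that the shift preserves inner products. Only
   [b 0, ..., b (n-1)] are shifted, since [b n] has no successor. *)
have [i j i_n j_n|U Uu UE] := @unitary_extension n.+1 n b (fun i => b i.+1).
  by rewrite !bE ?(ltnW i_n) ?(ltnW j_n) // /toeplitz_coef ltnS !subSS.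
have [P [D [Pu UD D1]]] := @unitary_spectrum _ _ Uu.
pose v := b 0%N *m P^t*.
have bP j : (j <= n)%N -> b j *m P^t* = v *m diag_mx (\row_k D 0 k ^+ j).
  elim: j => [_|j IH j_n].
    rewrite [diag_mx _](_ : _ = 1%:M) ?mulmx1 //.
    by apply/matrixP=> k l; rewrite !mxE expr0.
  rewrite -UE // UD !mulmxA (mulmxtVK _ Pu) IH ?(ltnW j_n) // -mulmxA mulmx_diag.
  by congr (_ *m diag_mx _); apply/rowP=> k; rewrite !mxE exprSr.
exists (fun k => `|v 0 k| ^+ 2), (fun k => D 0 k); split=> // [k|j j_n].
  by rewrite exprn_ge0.
have := bE j 0%N j_n (leq0n n).
rewrite -[b j](mulmxKtV _ Pu) // bP // -mulmxA.
have -> : P *m (b 0%N)^t* = v^t* by rewrite adjM trmxCK.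
move=> /matrixP/(_ 0 0).
rewrite [RHS]mxE eqxx mulr1n /toeplitz_coef leq0n subn0 => <-.
rewrite mxE; apply: eq_bigr => k _; rewrite mul_mx_diag !mxE.
by rewrite mulrAC -normCK.
Qed.

End Unitary.

(** * Polynomials in [z] and its conjugate, through their coefficients *)

Section BiPoly.
Variable C : numClosedFieldType.
Implicit Types (p q : {poly C}) (h : {poly {poly C}}).

Lemma bicoef_inj h1 h2 : bicoef h1 =2 bicoef h2 -> h1 = h2.
Proof. by move=> E; apply/polyP=> k; apply/polyP=> j; apply: E. Qed.

Lemma bicoefD h1 h2 j k : bicoef (h1 + h2) j k = bicoef h1 j k + bicoef h2 j k.
Proof. by rewrite /bicoef !coefD. Qed.

Lemma bicoef_sum I (r : seq I) (P : pred I) (F : I -> {poly {poly C}}) j k :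
  bicoef (\sum_(i <- r | P i) F i) j k = \sum_(i <- r | P i) bicoef (F i) j k.
Proof. by rewrite /bicoef !coef_sum. Qed.

Lemma bicoefZ (a : C) h j k : bicoef (a%:P%:P * h) j k = a * bicoef h j k.
Proof. by rewrite /bicoef !coefCM. Qed.

Lemma bicoef_polyC p j k : bicoef p%:P j k = p`_j *+ (k == 0%N).
Proof. by rewrite /bicoef coefC; case: eqP; rewrite ?coef0. Qed.

Lemma bicoef_mono a b j k : bicoef (bimono C a b) j k = ((a == j) && (b == k))%:R.
Proof.
rewrite /bicoef /bimono coefCM coefXn eq_sym; case: (b == k).
  by rewrite mulr1 coefXn andbT eq_sym.
by rewrite mulr0 coef0 andbF.
Qed.

(** At most one monomial of the double sum contributes. Indices beyond the summation ranges give an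
    empty contribution, in agreement with the default coefficient 0 of [h]. *)
Lemma bicoef_biconj h j k : bicoef (biconj h) j k = (bicoef h k j)^*.
Proof.
rewrite /biconj bicoef_sum.
under eq_bigr => a _ do rewrite bicoef_sum.
have [hj|hj] := ltnP j (size h); last first.
  rewrite big1 => [|a _].
    by rewrite /bicoef (nth_default _ hj) coef0 conjC0.
  rewrite big1 // => b _; rewrite bicoefZ bicoef_mono.
  by rewrite (ltn_eqF (leq_trans (ltn_ord a) hj)) mulr0.
rewrite (bigD1 (Ordinal hj)) //= [X in _ + X]big1 => [|a /eqP aj]; last first.
  rewrite big1 // => b _; rewrite bicoefZ bicoef_mono.
  case: eqP => [e|_]; last by rewrite mulr0.
  by case: aj; apply: val_inj.
rewrite addr0; have [hk|hk] := ltnP k (size h`_j); last first.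
  rewrite big1 => [|b _]; first by rewrite /bicoef (nth_default _ hk) conjC0.
  rewrite bicoefZ bicoef_mono.
  by rewrite (ltn_eqF (leq_trans (ltn_ord b) hk)) andbF mulr0.
rewrite (bigD1 (Ordinal hk)) //= [X in _ + X]big1 => [|b /eqP bk]; last first.
  rewrite bicoefZ bicoef_mono; case: (b =P k :> nat) => [e|_].
    by case: bk; apply: val_inj.
  by rewrite andbF mulr0.
by rewrite addr0 bicoefZ bicoef_mono !eqxx mulr1.
Qed.

Lemma biconj_polyC p : biconj p%:P = map_poly polyC (map_poly Num.conj p).
Proof.
apply: bicoef_inj => j k; rewrite bicoef_biconj bicoef_polyC.
rewrite /bicoef !coef_map /= coefC.
by case: eqP; rewrite ?conjC0.
Qed.

Lemma bicoef_herm p q j k : bicoef (p%:P * biconj q%:P) j k = p`_j * (q`_k)^*.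
Proof. by rewrite /bicoef coefCM biconj_polyC !coef_map /= coefMC. Qed.

Lemma biconj_herm p q : biconj (p%:P * biconj q%:P) = q%:P * biconj p%:P.
Proof.
apply: bicoef_inj => j k; rewrite bicoef_biconj !bicoef_herm.
by rewrite rmorphM /= conjCK mulrC.
Qed.

Lemma biconj1 : biconj 1%:P = 1 :> {poly {poly C}}.
Proof. by rewrite biconj_polyC !rmorph1. Qed.

Lemma in_tdeg_herm n p q : (size p <= n.+1)%N -> (size q <= n.+1)%N ->
  in_tdeg (2 * n) (p%:P * biconj q%:P).
Proof.
move=> pn qn j k njk; rewrite bicoef_herm.
have [pj|pj] := leqP (size p) j; first by rewrite nth_default ?mul0r.
have jn := leq_trans pj pn.
by rewrite [q`_k]nth_default ?conjC0 ?mulr0 //; apply: leq_trans qn _; lia.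
Qed.

Lemma eval2D h1 h2 z : eval2 (h1 + h2) z = eval2 h1 z + eval2 h2 z.
Proof. by rewrite /eval2 (rmorphD (map_poly (horner_eval z))) hornerD. Qed.

Lemma eval2_polyC p z : eval2 p%:P z = p.[z].
Proof. by rewrite /eval2 (map_polyC (horner_eval z)) hornerC. Qed.

Lemma eval2_biconj p z : eval2 (biconj p%:P) z = (p.[z])^*.
Proof.
rewrite /eval2 biconj_polyC -horner_map; congr (_.[_]); apply/polyP=> i.
by rewrite (coef_map (horner_eval z)) !coef_map /= /horner_eval hornerC.
Qed.

(** Harmonicity kills each mixed coefficient, since it occurs in the mixed derivative multiplied by
    a nonzero integer and the characteristic is zero. Only pure powers of [z] and of its conjugate
    remain. *)
Lemma harmonic_split n h : in_bideg n n h -> harmonic h ->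
  exists p q, [/\ (size p <= n.+1)%N, (size q <= n.+1)%N & h = p%:P + biconj q%:P].
Proof.
(* The constant term is left to [p], so [q] omits it to avoid counting it twice. *)
move=> hn hh; pose q := \poly_(k < n.+1) ((bicoef h 0 k)^* *+ (k != 0%N)).
exists h`_0, q; split; last 1 first.
- apply: bicoef_inj => j k; rewrite bicoefD bicoef_biconj !bicoef_polyC.
  rewrite coef_poly ltnS.
  case: k => [|k]; first by rewrite /= mulr0n mul0rn conjC0 addr0.
  rewrite add0r mulr1n; case: j => [|j].
    rewrite !mulr1n; case: ltnP => [_|nk]; first by rewrite conjCK.
    by rewrite conjC0 hn // ltnS nk orbT.
  have := congr1 (fun g : {poly {poly C}} => g`_k`_j) hh.
  rewrite mulr0n conjC0 !coef0 (coef_map (@deriv C)).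
  rewrite !coef_deriv coefMn => /eqP; rewrite -mulrnA mulrn_eq0 muln_eq0 /=.
  by move/eqP.
- by apply/leq_sizeP => j nj; apply: (hn j 0%N); rewrite nj.
- exact: size_poly.
Qed.

End BiPoly.

(** * The semi-inner product defined by [L] *)

Section Functional.
Variables (C : numClosedFieldType) (d : nat) (L : {poly {poly C}} -> C).
Hypothesis L_lin : forall (a : C) (p q : {poly {poly C}}),
  in_tdeg (2 * d + 2) p -> in_tdeg (2 * d + 2) q ->
  L (a%:P%:P * p + q) = a * L p + L q.
Hypothesis L_real : forall p : {poly {poly C}},
  in_tdeg (2 * d + 2) p -> L (biconj p) = (L p)^*.
Hypothesis L_pos : forall f : {poly C}, (size f <= d.+2)%N -> 0 <= ipL L f f.

Implicit Types p q r : {poly C}.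

Lemma in_tdeg_ip p q : (size p <= d.+2)%N -> (size q <= d.+2)%N ->
  in_tdeg (2 * d + 2) (p%:P * biconj q%:P).
Proof. by rewrite -mulnSr; apply: in_tdeg_herm. Qed.

Lemma ipL_linear a p q r :
    (size p <= d.+2)%N -> (size q <= d.+2)%N -> (size r <= d.+2)%N ->
  ipL L (a *: p + q) r = a * ipL L p r + ipL L q r.
Proof.
move=> pd qd rd; rewrite /ipL -L_lin; [|exact: in_tdeg_ip|exact: in_tdeg_ip].
by rewrite polyCD -mul_polyC polyCM mulrDl mulrA.
Qed.

Lemma ipL_conj p q : (size p <= d.+2)%N -> (size q <= d.+2)%N ->
  ipL L q p = (ipL L p q)^*.
Proof. by move=> pd qd; rewrite /ipL -biconj_herm L_real //; exact: in_tdeg_ip. Qed.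

Lemma ipL0l r : (size r <= d.+2)%N -> ipL L 0 r = 0.
Proof.
move=> rd; have := @ipL_linear 1 0 0 r.
rewrite scaler0 addr0 mul1r size_poly0 => /(_ isT isT rd) /eqP.
by rewrite -subr_eq0 opprD addNKr oppr_eq0 => /eqP.
Qed.

Lemma ipLD p q r :
    (size p <= d.+2)%N -> (size q <= d.+2)%N -> (size r <= d.+2)%N ->
  ipL L (p + q) r = ipL L p r + ipL L q r.
Proof. by move=> *; rewrite -[p]scale1r ipL_linear // mul1r scale1r. Qed.

Lemma ipLZ a p r : (size p <= d.+2)%N -> (size r <= d.+2)%N ->
  ipL L (a *: p) r = a * ipL L p r.
Proof.
move=> pd rd; rewrite -[a *: p]addr0 ipL_linear ?size_poly0 //.
by rewrite ipL0l // addr0.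
Qed.

Lemma ipL_sum n (F : 'I_n -> {poly C}) r :
    (forall i, (size (F i) <= d.+2)%N) -> (size r <= d.+2)%N ->
  ipL L (\sum_i F i) r = \sum_i ipL L (F i) r.
Proof.
move=> Fd rd.
(* The degree bound is carried along with the value because additivity is available only below
   degree [d + 2]. *)
pose ok p s := (size p <= d.+2)%N /\ ipL L p r = s.
suff [] : ok (\sum_i F i) (\sum_i ipL L (F i) r) by [].
apply: (big_ind2 ok) => [|p s q t [pd <-] [qd <-]|i _]; last by split.
  by split; rewrite ?size_poly0 // ipL0l.
split; last by rewrite ipLD.
by rewrite (leq_trans (size_polyD _ _)) // geq_max pd qd.
Qed.

Lemma normD_ipL p q : (size p <= d.+2)%N -> (size q <= d.+2)%N ->
  ipL L (p + q) (p + q) = ipL L p p + ipL L p q + (ipL L p q)^* + ipL L q q.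
Proof.
move=> pd qd; have pqd : (size (p + q)%R <= d.+2)%N.
  by rewrite (leq_trans (size_polyD _ _)) // geq_max pd qd.
rewrite ipLD // (ipL_conj _ p pqd pd) (ipL_conj _ q pqd qd) !ipLD // !rmorphD /=.
by rewrite -(ipL_conj p p) // -(ipL_conj q q) // -(ipL_conj q p) // !addrA.
Qed.

Lemma normZ_ipL a p : (size p <= d.+2)%N ->
  ipL L (a *: p) (a *: p) = `|a| ^+ 2 * ipL L p p.
Proof.
move=> pd; have apd : (size (a *: p)%R <= d.+2)%N := leq_trans (size_scale_leq _ _) pd.
rewrite ipLZ // (ipL_conj _ p apd pd) ipLZ // rmorphM /= -(ipL_conj p p) //.
by rewrite mulrA normCK.
Qed.

(** The degenerate case of Cauchy-Schwarz: if [s = <p, q>] were nonzero, the squared norm of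
    [q - c s^* p], namely [|q|^2 - 2 c |s|^2], would be negative for large [c]. *)
Lemma ipL_null p q : (size p <= d.+2)%N -> (size q <= d.+2)%N ->
  ipL L p p = 0 -> ipL L p q = 0.
Proof.
move=> pd qd pp; apply/eqP; apply: contraT => s0; set s := ipL L p q in s0 *.
have s2_gt0 : 0 < `|s| ^+ 2 by rewrite exprn_gt0 ?normr_gt0.
have sq_ge0 c : 0 <= c -> 0 <= ipL L q q - 2 * c * `|s| ^+ 2.
  move=> c_ge0; pose a := - c * s^*.
  have apd : (size (a *: p)%R <= d.+2)%N := leq_trans (size_scale_leq _ _) pd.
  have apq : (size (a *: p + q)%R <= d.+2)%N.
    by rewrite (leq_trans (size_polyD _ _)) // geq_max apd qd.
  have := L_pos _ apq; rewrite normD_ipL // normZ_ipL // pp mulr0 add0r ipLZ // -/s.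
  have -> : a * s = - (c * `|s| ^+ 2) by rewrite /a normCKC; ring.
  rewrite rmorphN /= conj_Creal ?ger0_real ?mulr_ge0 ?exprn_ge0 //.
  by congr (_ <= _); ring.
(* This value of [c] makes the squared norm equal to [-1]. *)
have c_ge0 : 0 <= (ipL L q q + 1) / (2 * `|s| ^+ 2).
  by rewrite divr_ge0 ?addr_ge0 ?L_pos // mulr_ge0 ?ler0n // ltW.
have := sq_ge0 _ c_ge0.
have -> : ipL L q q - 2 * ((ipL L q q + 1) / (2 * `|s| ^+ 2)) * `|s| ^+ 2 = - 1.
  by move/lt0r_neq0: s2_gt0; move: (`|s| ^+ 2) => e e0; field.
by rewrite oppr_ge0 ler10.
Qed.

(** * The Toeplitz form dominates the norm when [rho z] acts as a contraction *)

Section Contraction.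
Variable rho : C.
Hypothesis contr : forall p : {poly C}, (size p <= d)%N ->
  ipL L (rho *: ('X * p)) (rho *: ('X * p)) <= ipL L p p.

Let t n := rho ^+ n * ipL L 'X^n 1.
Let y m (a : nat -> C) : {poly C} := \sum_(i < m) (a i * rho ^+ i) *: 'X^i.
Lemma size_scaled_poly m a : (size (y m a) <= m)%N.
Proof.
apply: (leq_trans (size_sum _ _ _)); apply/bigmax_leqP => i _.
by rewrite (leq_trans (size_scale_leq _ _)) // size_polyXn.
Qed.

Lemma toeplitz_contraction_ge m a : (m <= d.+1)%N ->
  ipL L (y m a) (y m a)
    <= \sum_(i < m) \sum_(j < m) a i * (a j)^* * toeplitz_coef t i j.
Proof.
elim: m a => [|m IH] a md.
  by rewrite /y !big_ord0 ipL0l ?size_poly0.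
set a' := fun i => a i.+1.
pose u := rho *: ('X * y m a').
have ys : (size (y m a') <= d)%N by apply: leq_trans (size_scaled_poly _ _) _.
have Xys : (size ('X * y m a')%R <= d.+1)%N.
  by rewrite mulrC (leq_trans (size_polyMleq _ _)) // size_polyX addn2.
have us : (size u <= d.+2)%N by apply: leq_trans (size_scale_leq _ _) (leqW Xys).
have s1 : (size (1 : {poly C})%R <= d.+2)%N by rewrite size_poly1.
have yE : y m.+1 a = (a 0%N)%:P + u.
  rewrite /y big_ord_recl expr0 mulr1 alg_polyC; congr (_ + _).
  rewrite /u mulr_sumr scaler_sumr; apply: eq_bigr => i _.
  by rewrite -scalerAr -exprS scalerA mulrCA -exprS.
have u1 : ipL L u 1 = \sum_(i < m) a' i * t i.+1.
  have -> : u = \sum_(i < m) (a' i * rho ^+ i.+1) *: 'X^(i.+1).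
    rewrite /u mulr_sumr scaler_sumr; apply: eq_bigr => i _.
    by rewrite -scalerAr -exprS scalerA mulrCA -exprS.
  have Xs (i : 'I_m) : (size ('X^(i.+1) : {poly C})%R <= d.+2)%N.
    by rewrite size_polyXn ltnW // !ltnS (leq_trans (ltn_ord i)).
  rewrite ipL_sum // => [|i]; last exact: leq_trans (size_scale_leq _ _) (Xs i).
  by apply: eq_bigr => i _; rewrite ipLZ // /t mulrA.
have t00 : ipL L 1 1 = t 0%N by rewrite /t expr0 mul1r.
have IHa := IH a' (ltnW md).
have -> : \sum_(i < m.+1) \sum_(j < m.+1) a i * (a j)^* * toeplitz_coef t i j
   = ipL L (y m.+1 a) (y m.+1 a) - ipL L u u
     + \sum_(i < m) \sum_(j < m) a' i * (a' j)^* * toeplitz_coef t i j.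
  rewrite yE -alg_polyC normD_ipL ?(leq_trans (size_scale_leq _ _) s1) // addrK normZ_ipL // ipLZ //.
  rewrite (ipL_conj u) // u1 t00.
  rewrite big_ord_recl big_ord_recl /=.
  under [X in _ + X]eq_bigr => i _ do rewrite big_ord_recl.
  rewrite big_split /= !addrA; congr (_ + _ + _ + _).
  - by rewrite /toeplitz_coef /= normCK.
  - rewrite rmorph_sum mulr_sumr; apply: eq_bigr => i _.
    by rewrite rmorphM mulrA.
  - rewrite rmorphM /= conjCK mulr_sumr; apply: eq_bigr => i _.
    by rewrite /toeplitz_coef /= [_ * _^*]mulrC mulrA.
rewrite -addrA lerDl addrC subr_ge0; apply: le_trans IHa.
exact: contr.
Qed.
End Contraction.

(** * Atoms on the circle of radius [R] and quadrature for harmonic polynomials *)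

Lemma circle_moments (R : C) : 0 <= R ->
    (forall p : {poly C}, (size p <= d)%N ->
       ipL L ('X * p) ('X * p) <= R ^+ 2 * ipL L p p) ->
  exists (w z : 'I_d.+1 -> C), [/\ forall k, 0 <= w k, forall k, `|z k| = R &
    forall j, (j <= d)%N -> ipL L 'X^j 1 = \sum_k w k * z k ^+ j].
Proof.
move=> R_ge0 contr.
have s1 : (size (1 : {poly C})%R <= d.+2)%N by rewrite size_poly1.
have [R0|R_neq0] := eqVneq R 0.
  (* For [R = 0] the circle is the origin. The bound makes [z^j] a null vector for [0 < j <= d], so
     its moment vanishes and the whole mass [L(1)] sits at 0. *)
  exists (fun k => ipL L 1 1 *+ (k == ord0)), (fun=> 0); split=> [k|k|j jd].
  - by rewrite mulrn_wge0 // L_pos.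
  - by rewrite R0 normr0.
  rewrite (bigD1 ord0) //= big1 ?addr0 => [|k /negPf->]; last by rewrite mul0r.
  rewrite mulr1n; case: j jd => [|j] jd; first by rewrite mulr1.
  rewrite expr0n mulr0; apply: ipL_null => //; first by rewrite size_polyXn ltnW.
  apply/le_anti; rewrite L_pos ?size_polyXn 1?ltnW // andbT exprS.
  apply: le_trans (contr _ _) _; first by rewrite size_polyXn.
  by rewrite R0 expr0n mul0r.
have [||w [z [w_ge0 z1 tE]]] :=
    toeplitz_moments C d (fun n => R^-1 ^+ n * ipL L 'X^n 1).
- by rewrite expr0 mul1r conj_Creal // ger0_real // L_pos.
- move=> a; apply: le_trans (toeplitz_contraction_ge R^-1 _ d.+1 a (leqnn _)).
    by apply/L_pos/leqW/size_scaled_poly.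
  move=> p pd; have Xpd : (size ('X * p)%R <= d.+2)%N.
    by rewrite mulrC (leq_trans (size_polyMleq _ _)) // size_polyX addn2 !ltnS leqW.
  rewrite normZ_ipL // ger0_norm ?invr_ge0 // exprVn.
  by rewrite ler_pdivrMl ?contr // exprn_gt0 // lt0r R_neq0.
(* The moments were divided by [R^j]; scaling the unit-circle atoms by [R] undoes this. *)
exists w, (fun k => R * z k); split=> // [k|j jd].
  by rewrite normrM z1 mulr1 ger0_norm.
have /(congr1 (fun x => R ^+ j * x)) := tE j jd.
rewrite mulrA -exprMn divff // expr1n mul1r => ->.
by rewrite mulr_sumr; apply: eq_bigr => k _; rewrite exprMn mulrCA.
Qed.

(** The moments determine [L] on holomorphic polynomials of degree at most [d]. Since [L] and the
    weights are real, conjugation gives the formula on antiholomorphic ones, and harmonic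
    polynomials are sums of the two. *)
Lemma harmonic_quadrature n (w z : 'I_n -> C) :
    (forall k, 0 <= w k) ->
    (forall j, (j <= d)%N -> ipL L 'X^j 1 = \sum_k w k * z k ^+ j) ->
  forall h, in_bideg d d h -> harmonic h -> L h = \sum_k w k * eval2 h (z k).
Proof.
move=> w_ge0 momE h hd hh.
have s1 : (size (1 : {poly C})%R <= d.+2)%N by rewrite size_poly1.
have ipE p : (size p <= d.+1)%N -> ipL L p 1 = \sum_k w k * p.[z k].
  move=> pd; have pE : p = \sum_(j < d.+1) p`_j *: 'X^j.
    rewrite -(poly_def d.+1 (fun j => p`_j)); apply/polyP=> i.
    by rewrite coef_poly; case: ltnP => // /(leq_trans pd)/(nth_default 0)->.
  have Xd (j : 'I_d.+1) : (size ('X^j : {poly C})%R <= d.+2)%N.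
    by rewrite size_polyXn ltnS ltnW.
  rewrite {1}pE ipL_sum // => [|j]; last exact: leq_trans (size_scale_leq _ _) (Xd j).
  rewrite (eq_bigr (fun j : 'I_d.+1 => \sum_k p`_j * (w k * z k ^+ j))) => [|j _].
    rewrite exchange_big; apply: eq_bigr => k _ /=.
    rewrite (horner_coef_wide _ pd) mulr_sumr.
    by apply: eq_bigr => j _; rewrite mulrCA.
  by rewrite ipLZ // momE ?mulr_sumr // -ltnS.
have [p [q [pd qd ->]]] := harmonic_split C d h hd hh.
have tdeg r : (size r <= d.+1)%N -> in_tdeg (2 * d + 2) r%:P.
  move=> rd; rewrite -[r%:P]mulr1 -(biconj1 C); apply: in_tdeg_ip => //.
  exact: leqW.
have L1 r : L r%:P = ipL L r 1 by rewrite /ipL biconj1 mulr1.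
have tdegc : in_tdeg (2 * d + 2) (biconj q%:P).
  by move=> j k jk; rewrite bicoef_biconj (tdeg q qd) ?conjC0 // (addnC k).
have -> : L (p%:P + biconj q%:P) = ipL L p 1 + (ipL L q 1)^*.
  have := L_lin 1 p%:P (biconj q%:P) (tdeg _ pd) tdegc.
  by rewrite !rmorph1 !mul1r L_real ?L1 //; apply: tdeg.
rewrite !ipE // rmorph_sum -big_split; apply: eq_bigr => k _ /=.
by rewrite eval2D eval2_polyC eval2_biconj mulrDr rmorphM /= conj_Creal ?ger0_real.
Qed.

End Functional.

Theorem theorem1 (C : numClosedFieldType) (d : nat) (L : {poly {poly C}} -> C)
  (L_lin : forall (a : C) (p q : {poly {poly C}}),
      in_tdeg (2 * d + 2) p -> in_tdeg (2 * d + 2) q ->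
      L (a%:P%:P * p + q) = a * L p + L q)
  (L_real : forall p : {poly {poly C}},
      in_tdeg (2 * d + 2) p -> L (biconj p) = (L p)^*)
  (L_pos : forall f : {poly C}, (size f <= d.+2)%N -> 0 <= ipL L f f)
  (Mz_wd : forall p : {poly C}, (size p <= d.+1)%N ->
      ipL L p p = 0 -> ipL L ('X * p) ('X * p) = 0)
  (R : C) (HR : is_opnorm_Md L d R) :
  exists (N : nat) (z : 'I_N -> C) (c : 'I_N -> C),
    [/\ (N <= (d.+1) ^ 2)%N,
        (forall k, `|z k| = R),
        (forall k, 0 < c k)
      & forall h : {poly {poly C}}, in_bideg d d h -> harmonic h ->
          L h = \sum_(k < N) c k * eval2 h (z k)].

Proof.
have [R_ub _] := HR.
have R_ge0 : 0 <= R.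
  (* The zero vector shows that 0 is among the values bounded by [R]. *)
  apply: R_ub; exists 0, 0; have L0 : ipL L 0 0 = 0.
    by apply: (ipL0l C d L L_lin); rewrite size_poly0.
  rewrite L0 sqrtC0 ler01 size_poly0; split=> // q qd.
  by rewrite mulr0 subr0 (ipL0l C d L L_lin) // leqW.
have contr (p : {poly C}) : (size p <= d)%N -> ipL L ('X * p) ('X * p) <= R ^+ 2 * ipL L p p.
  move=> pd; have pd1 := leqW pd; have pd2 := leqW pd1.
  have Xpd : (size ('X * p)%R <= d.+1)%N.
    by rewrite mulrC (leq_trans (size_polyMleq _ _)) // size_polyX addn2 ltnS.
  (* A null vector cannot be normalised; here well-definedness of multiplication by [z] gives the
     bound. *)
  have [pp|pp] := eqVneq (ipL L p p) 0; first by rewrite Mz_wd // pp mulr0.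
  have pp_gt0 : 0 < ipL L p p by rewrite lt0r pp L_pos.
  pose b := (sqrtC (ipL L p p))^-1.
  have b2 : `|b| ^+ 2 = (ipL L p p)^-1.
    by rewrite ger0_norm ?invr_ge0 ?sqrtC_ge0 ?L_pos // exprVn sqrtCK.
  have normX : ipL L (b *: ('X * p)) (b *: ('X * p))
      = (ipL L p p)^-1 * ipL L ('X * p) ('X * p).
    by rewrite (normZ_ipL C d L L_lin L_real b _ (leqW Xpd)) b2.
  have sR : sqrtC (ipL L (b *: ('X * p)) (b *: ('X * p))) <= R.
    (* As [p] has degree below [d], the product [z p] stays in degree at most [d] and is its own
       projection, so it serves as [w] after normalisation by [b]. *)
    apply: R_ub; exists (b *: p), (b *: ('X * p)); split=> //.
    - exact: leq_trans (size_scale_leq _ _) pd1.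
    - exact: leq_trans (size_scale_leq _ _) Xpd.
    - by rewrite (normZ_ipL C d L L_lin L_real b _ pd2) b2 mulVf.
    - by move=> q qd; rewrite scalerAr subrr (ipL0l C d L L_lin) // leqW.
  rewrite [leRHS]mulrC -ler_pdivrMl // -normX -[leLHS]sqrtCK lerXn2r ?nnegrE // sqrtC_ge0.
  by rewrite normX mulr_ge0 ?invr_ge0 ?L_pos // leqW.
have [w [z [w_ge0 zR momE]]] := circle_moments C d L L_lin L_real L_pos R R_ge0 contr.
have LE := harmonic_quadrature C d L L_lin L_real _ w z w_ge0 momE.
(* Atoms of weight zero are discarded to get strict positivity. At most [d + 1] atoms remain, hence
   at most [(d + 1)^2]. *)
pose A := [set k | w k != 0].
exists #|A|, (z \o enum_val), (w \o enum_val); split=> [|k|k|h hd hh] /=.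
- rewrite (leq_trans (max_card _)) // card_ord expnS expn1.
  exact: leq_pmulr.
- exact: zR.
- by have := enum_valP k; rewrite inE lt0r w_ge0 andbT.
rewrite LE // (bigID (mem A)) /= [X in _ + X]big1 ?addr0 => [|k].
  by rewrite (big_enum_val (fun k => w k * eval2 h (z k))).
by rewrite inE negbK => /eqP->; rewrite mul0r.
Qed.
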